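(* Let $K$ be a field of characteristic $0$ and let $n\ge1$, $d\ge0$ be integers. Let $\Delta=\{(d_1,\dots,d_n)\in\mathbb{N}_0^n : d_1+\cdots+d_n\le d\}$, regarded as a set of $\binom{n+d}{d}$ points of $K^n$ via the inclusion $\mathbb{N}_0\subset K$. Then there exist polynomials $f_P\in K[X_1,\dots,X_n]$, one for each $P\in\Delta$, each of degree at most $d$, such that $f_P(P)\ne0$ for all $P\in\Delta$ and $f_P(Q)=0$ for all $P,Q\in\Delta$ with $Q\neq P$; and $\{f_P:P\in\Delta\}$ is a minimal generating set, of size $\binom{n+d}{d}$, of the ideal $I\subset K[X_1,\dots,X_n]$ it generates.
   Context: $\mathbb{N}_0$ is the set of nonnegative integers. A set $S\subset K[X_1,\dots,X_n]$ is called a minimal generating set of the ideal $I=(S)$ if no proper subset of $S$ generates $I$. Degree means total degree. The points of $\Delta$ are the ''evaluation points'': using evaluation points means exhibiting, for each point, a polynomial of degree at most $d$ that is nonzero at that point and zero at all other points of the set. *)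

(* Defs.v *)
From mathcomp Require Import all_boot all_order all_algebra.
From mathcomp Require Import boolp classical_sets functions cardinality.
From mathcomp Require Import mpoly.

Set Implicit Arguments.
Unset Strict Implicit.
Unset Printing Implicit Defensive.

Import GRing.Theory.
Local Open Scope ring_scope.
Local Open Scope classical_set_scope.

Definition Delta (n d : nat) : set 'X_{1..n} :=
  [set P | (mdeg P <= d)%N].

Arguments Delta : clear implicits.

Definition point_of (K : nzRingType) (n : nat) (P : 'X_{1..n}) : 'I_n -> K :=
  fun i => (P i)%:R.

Arguments point_of K {n} P i.

(* msize is the total degree plus one, and 0 for the zero polynomial. *)
Definition deg_le (K : nzRingType) (n : nat) (p : {mpoly K[n]}) (d : nat) : Prop :=
  (msize p <= d.+1)%N.

(* The entries of s are pairs (coefficient, generator). *)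
Definition ideal_gen (R : comNzRingType) (S : set R) : set R :=
  [set p | exists s : seq (R * R),
     (forall x, x \in s -> S x.2) /\ p = \sum_(x <- s) x.1 * x.2].

Definition minimal_generating_set (R : comNzRingType) (S I : set R) : Prop :=
  ideal_gen S = I /\ (forall T : set R, T `<` S -> ideal_gen T <> I).

(* Main.v *)
Require Import Defs.
From mathcomp Require Import all_boot all_order all_algebra.
From mathcomp Require Import boolp classical_sets functions cardinality.
From mathcomp Require Import mpoly.

Set Implicit Arguments.
Unset Strict Implicit.
Unset Printing Implicit Defensive.

Import GRing.Theory.
Local Open Scope ring_scope.
Local Open Scope classical_set_scope.

(** At a point [Q] of the simplex, the product of the linear factors [X_i - j]
    for [j < P_i] vanishes unless [P <= Q] coordinatewise, and the product of
    the factors [X_1 + ... + X_n - k] for [|P| < k <= d] vanishes unless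
    [|Q| <= |P|]; both conditions together force [Q = P].  The product of all
    [|P| + (d - |P|) = d] factors is therefore [f_P].  Evaluating at [P] kills
    every generator except [f_P], hence no [f_P] lies in the ideal generated
    by the others. *)

Lemma deg_leM (R : idomainType) (n : nat) (p q : {mpoly R[n]}) (a b : nat) :
  deg_le p a -> deg_le q b -> deg_le (p * q) (a + b).
Proof.
(* The zero polynomial has [msize] 0 rather than degree plus one, so [msizeM] only covers nonzero
   factors. *)
rewrite /deg_le; have [->|p0] := eqVneq p 0; first by rewrite mul0r msize0.
have [->|q0] := eqVneq q 0; first by rewrite mulr0 msize0.
move=> ha hb; rewrite msizeM //.
by rewrite -subn1 leq_subLR add1n -addnS -addSn leq_add.
Qed.

Lemma deg_le_prod (R : idomainType) (n : nat) (I : Type) (r : seq I)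
    (F : I -> {mpoly R[n]}) (a : I -> nat) :
  (forall i, deg_le (F i) (a i)) ->
  deg_le (\prod_(i <- r) F i) (\sum_(i <- r) a i).
Proof.
move=> hF; elim/big_ind2: _ => //; first by rewrite /deg_le msize1.
by move=> p a1 q b1; apply: deg_leM.
Qed.

Lemma deg_le_subC (R : nzRingType) (n : nat) (p : {mpoly R[n]}) (c : R) (d : nat) :
  deg_le p d -> deg_le (p - c%:MP) d.
Proof.
move=> hp; rewrite /deg_le (leq_trans (msizeD_le _ _)) // geq_max hp /=.
by rewrite msizeN msizeC; case: (c != 0).
Qed.

Lemma deg_le_X (R : nzRingType) (n : nat) (i : 'I_n) :
  deg_le ('X_i : {mpoly R[n]}) 1.
Proof. by rewrite /deg_le msizeX mdeg1. Qed.

Lemma deg_le_sumX (R : nzRingType) (n : nat) :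
  deg_le (\sum_(i < n) 'X_i : {mpoly R[n]}) 1.
Proof.
rewrite /deg_le (leq_trans (msize_sum _ _ _)) //.
by apply/bigmax_leqP => i _; apply: deg_le_X.
Qed.

Definition simplex_poly (K : nzRingType) (n d : nat) (P : 'X_{1..n}) :
    {mpoly K[n]} :=
  (\prod_(i < n) \prod_(0 <= j < P i) ('X_i - j%:R%:MP)) *
  \prod_((mdeg P).+1 <= k < d.+1) (\sum_(i < n) 'X_i - k%:R%:MP).

Lemma simplex_poly_deg (K : idomainType) (n d : nat) (P : 'X_{1..n}) :
  Delta n d P -> deg_le (simplex_poly K d P) d.
Proof.
rewrite /Delta /= => hP.
(* Writing [d] as the sum of all [P i] plus [d - mdeg P] gives the bound the shape of the product,
   one unit per linear factor. *)
rewrite -[X in deg_le _ X](subnKC hP) [X in (X + _)%N]mdegE.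
apply: deg_leM.
  apply: deg_le_prod => i.
  rewrite -[X in deg_le _ X]subn0 -[X in deg_le _ X]muln1 -sum_nat_const_nat.
  by apply: deg_le_prod => j; apply/deg_le_subC/deg_le_X.
rewrite -subSS -[X in deg_le _ X]muln1 -sum_nat_const_nat.
by apply: deg_le_prod => k; apply/deg_le_subC/deg_le_sumX.
Qed.

Lemma meval_simplex_poly (K : comNzRingType) (n d : nat) (P Q : 'X_{1..n}) :
  (simplex_poly K d P).@[point_of K Q] =
    (\prod_(i < n) \prod_(0 <= j < P i) ((Q i)%:R - j%:R)) *
    \prod_((mdeg P).+1 <= k < d.+1) ((mdeg Q)%:R - k%:R).
Proof.
rewrite mevalM !rmorph_prod /=; congr (_ * _).
  apply: eq_bigr => i _; rewrite rmorph_prod; apply: eq_bigr => j _.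
  by rewrite /= mevalB mevalXU mevalC.
apply: eq_bigr => k _; rewrite mevalB mevalC rmorph_sum mdegE natr_sum /=.
by congr (_ - _); apply: eq_bigr => i _; rewrite mevalXU.
Qed.

Lemma subr_natr_neq0 (K : fieldType) (a b : nat) : [pchar K] =i pred0 ->
  a != b -> a%:R - b%:R != 0 :> K.
Proof.
move=> K0; wlog lt_ba : a b / (b < a)%N => [hw | _].
  rewrite neq_ltn => /orP[] lt_ab; last by apply: hw; rewrite // neq_ltn lt_ab orbT.
  by rewrite -oppr_eq0 opprB; apply: hw; rewrite // neq_ltn lt_ab orbT.
by rewrite -natrB ?(ltnW lt_ba) // ((pcharf0P K).1 K0) -lt0n subn_gt0.
Qed.

(** At [P] each factor is a difference of distinct naturals, as [j < P i] and [k > mdeg P];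
    characteristic 0 keeps it nonzero. *)
Lemma simplex_poly_self (K : fieldType) (n d : nat) (P : 'X_{1..n}) :
  [pchar K] =i pred0 -> (simplex_poly K d P).@[point_of K P] != 0.
Proof.
move=> K0; rewrite meval_simplex_poly mulf_neq0 //.
  apply/prodf_neq0 => i _; rewrite prodf_seq_neq0; apply/allP => j.
  rewrite mem_index_iota /= => lt_jP; apply: subr_natr_neq0 => //.
  by rewrite neq_ltn lt_jP orbT.
rewrite prodf_seq_neq0; apply/allP => k.
rewrite mem_index_iota /= => /andP[lt_Pk _]; apply: subr_natr_neq0 => //.
by rewrite neq_ltn lt_Pk.
Qed.

Lemma simplex_poly_other (K : idomainType) (n d : nat) (P Q : 'X_{1..n}) :
  Delta n d Q -> Q != P -> (simplex_poly K d P).@[point_of K Q] = 0.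
Proof.
rewrite /Delta /= => hQ neqQP; rewrite meval_simplex_poly; apply/eqP.
rewrite mulf_eq0; have [le_QP|lt_PQ] := leqP (mdeg Q) (mdeg P); last first.
  (* The factor [k = mdeg Q] occurs because [mdeg P < mdeg Q <= d]. *)
  apply/orP; right; rewrite prodf_seq_eq0; apply/hasP; exists (mdeg Q).
    by rewrite mem_index_iota lt_PQ ltnS.
  by rewrite subrr /=.
apply/orP; left; have [le_PQ|] := boolP [forall i, P i <= Q i]%N.
  case/negP: neqQP; apply/eqP/mnmP => i.
  have lePQ j : (P j <= Q j)%N by apply/forallP: j.
  (* One strict coordinate on top of [P <= Q] would force [mdeg P < mdeg Q]. *)
  apply/eqP; rewrite eqn_leq lePQ andbT leqNgt; apply/negP => lt_i.
  have : (mdeg P < mdeg Q)%N; last by rewrite ltnNge le_QP.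
  rewrite !mdegE (bigD1 i) //= [ltnRHS](bigD1 i) //=.
  by rewrite -addSn leq_add // leq_sum.
rewrite negb_forall => /existsP[i]; rewrite -ltnNge => lt_QP.
rewrite prodf_seq_eq0; apply/hasP; exists i; first exact: mem_index_enum.
rewrite /= prodf_seq_eq0; apply/hasP; exists (Q i).
  by rewrite mem_index_iota.
by rewrite subrr /=.
Qed.

(** Coordinates of points of the simplex are at most [d], so the points correspond to the [n]-tuples
    over ['I_d.+1] with sum at most [d], a finite type count already known. *)
Lemma card_Delta (n d : nat) : (Delta n d #= `I_('C(n + d, d)))%card.
Proof.
pose A := [set t : n.-tuple 'I_d.+1 | (\sum_(i <- t) i <= d)%N]%SET.
pose g (k : 'I_#|A|) := [multinom tnth (enum_val k) i : nat | i < n].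
have g_inj : injective g.
  move=> k l eq_g; apply/enum_val_inj/eq_from_tnth => i; apply: val_inj.
  by have /mnmP/(_ i) := eq_g; rewrite !mnmE.
have -> : Delta n d = g @` [set: 'I_#|A|].
  apply/seteqP; split=> [P /= dP | _ [k _ <-]]; last first.
    have := enum_valP k; rewrite inE /Delta /= big_tuple mdegE.
    by under [X in _ -> is_true (X <= _)%N]eq_bigr do rewrite mnmE.
  have leP i : (P i <= d)%N.
    by apply: leq_trans dP; rewrite mdegE (bigD1 i) //= leq_addr.
  pose t := [tuple (inord (P i) : 'I_d.+1) | i < n].
  have tA : t \in A.
    rewrite inE big_tuple (leq_trans _ dP) // mdegE leq_sum // => i _.
    by rewrite tnth_mktuple inordK ?ltnS.
  exists (enum_rank_in tA t) => //; apply/mnmP => i.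
  by rewrite mnmE enum_rankK_in // tnth_mktuple inordK ?ltnS.
(* By symmetry the binomial becomes ['C(n + d, n)], the known value of [#|A|]. *)
rewrite -bin_sub ?leq_addl // addnK -card_partial_ord_partitions.
apply: (card_eq_trans (inj_card_eq (in2W g_inj))).
by rewrite card_eq_sym; apply: card_II.
Qed.

Lemma sub_ideal_gen (R : comNzRingType) (S : set R) : S `<=` ideal_gen S.
Proof.
move=> p Sp; exists [:: (1, p)]; split; last by rewrite big_seq1 mul1r.
by move=> x; rewrite inE => /eqP ->.
Qed.

Lemma meval_ideal_gen (K : comNzRingType) (n : nat) (v : 'I_n -> K)
    (S : set {mpoly K[n]}) (p : {mpoly K[n]}) :
  (forall q, S q -> q.@[v] = 0) -> ideal_gen S p -> p.@[v] = 0.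
Proof.
move=> S0 [s [sS ->]]; rewrite rmorph_sum big_seq big1 // => x xs.
by rewrite /= mevalM (S0 _ (sS x xs)) mulr0.
Qed.

Theorem proposition4p1 (K : fieldType) (charK0 : [pchar K] =i pred0)
    (n d : nat) (n_ge1 : (1 <= n)%N) :
  exists f : 'X_{1..n} -> {mpoly K[n]},
    [/\ forall P, Delta n d P -> deg_le (f P) d,
        forall P, Delta n d P -> (f P).@[point_of K P] != 0,
        forall P Q, Delta n d P -> Delta n d Q -> Q != P ->
          (f P).@[point_of K Q] = 0,
        minimal_generating_set (f @` Delta n d) (ideal_gen (f @` Delta n d))
      & (f @` Delta n d #= `I_('C(n + d, d)))%card].
Proof.
have self (P : 'X_{1..n}) := simplex_poly_self d P charK0.
exists (simplex_poly K d); split => //.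
- by move=> P; apply: simplex_poly_deg.
- by move=> P Q _; apply: simplex_poly_other.
(* If [T] missed the generator of [P], each element of [T] would belong to some [Q != P] and vanish
   at [P]; so would that generator, which lies in the ideal of [T]. *)
- split=> // T [TS nST] eqT; apply: nST => _ [P dP <-].
  apply: contrapT => nTP; case/eqP: (self P).
  apply: (@meval_ideal_gen _ _ _ T); last first.
    by rewrite eqT; apply: sub_ideal_gen; exists P.
  move=> q Tq; have [Q dQ eq_q] := TS q Tq; rewrite -eq_q.
  apply: simplex_poly_other => //; apply: contra_notN nTP => /eqP ->.
  by rewrite eq_q.
(* Distinct points give distinct polynomials: the value at [P] separates them. *)
apply: (card_eq_trans _ (card_Delta n d)); apply: inj_card_eq => P Q.
rewrite !inE => dP dQ eqPQ; apply/eqP; apply: contraT => neqPQ.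
by have := self P; rewrite eqPQ simplex_poly_other ?eqxx.
Qed.
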